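(* Let $T$ be a locally finite tree and $S$ a tree with $S\approx T$. If there exists an embedding $\psi\colon S\to T$ such that some connected component of $T-\psi(S)$ is not nearly finite, then $m(T)$ is infinite.
   Context: An embedding is an injective graph homomorphism; for trees we write $S\approx T$ if each embeds into the other. $T-\psi(S)$ is the graph obtained from $T$ by deleting the vertices of $\psi(S)$. A tree is locally finite if all degrees are finite; it is nearly finite if it is locally finite and has only finitely many vertices of degree at least $3$. The twin number $m(T)$ is the cardinality of the set of isomorphism classes of trees $T'$ with $T'\approx T$. *)

(* Defs.v *)
From Stdlib Require Import Relation_Operators.
From mathcomp Require Import all_boot all_classical.

Set Implicit Arguments.
Unset Strict Implicit.
Unset Printing Implicit Defensive.

Local Open Scope classical_set_scope.
Local Open Scope card_scope.

(* Vertices form a bare Type, and induced subgraphs use [sig] instead of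
   [set_type]: the universes of choiceType and of [set_type] are too large for
   [set graph] to be well formed. *)
Record graph := Graph {
  vertex :> Type;
  adj : vertex -> vertex -> Prop;
  adj_sym : forall x y, adj x y -> adj y x;
  adj_irr : forall x, ~ adj x x
}.
Arguments adj {g}.

Implicit Types G H : graph.

Definition joined G : G -> G -> Prop := clos_refl_trans G adj.

Definition connected G : Prop :=
  [set: G] !=set0 /\ forall x y : G, joined x y.

Definition is_cycle G (n : nat) (c : 'I_n -> G) : Prop :=
  [/\ 2 < n, injective c & forall i, adj (c i) (c (ordS i))].

Definition acyclic G : Prop := forall n (c : 'I_n -> G), ~ is_cycle c.

Definition is_tree G : Prop := connected G /\ acyclic G.

Definition neighbours G (x : G) : set G := [set y | adj x y].

Definition locally_finite G : Prop := forall x : G, finite_set (neighbours x).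

Definition branch_vertices G : set G := [set x | `I_3 #<= neighbours x].
Arguments branch_vertices G : clear implicits.

Definition nearly_finite G : Prop :=
  locally_finite G /\ finite_set (branch_vertices G).

Definition embedding G H (f : G -> H) : Prop :=
  injective f /\ forall x y, adj x y -> adj (f x) (f y).

Definition embeds G H : Prop := exists f : G -> H, embedding f.

Definition twin G H : Prop := embeds G H /\ embeds H G.

Definition isomorphic G H : Prop :=
  exists f : G -> H, bijective f /\ forall x y, adj (f x) (f y) <-> adj x y.

Definition induced G (A : set G) : graph :=
  @Graph {x : G | A x} (fun x y => adj (sval x) (sval y))
    (fun x y => @adj_sym G (sval x) (sval y)) (fun x => @adj_irr G (sval x)).

Definition delete G (A : set G) : graph := induced (~` A).

(* The connected components, given by their vertex sets. *)
Definition components G : set (set G) := range (@joined G).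
Arguments components G : clear implicits.

Definition iso_class G : set graph := [set H | isomorphic G H].
Arguments iso_class G : clear implicits.

(* The set whose cardinality is the twin number m(G). *)
Definition twin_classes G : set (set graph) :=
  iso_class @` [set H | is_tree H /\ twin H G].
Arguments twin_classes G : clear implicits.

(* Main.v *)
(* Composing the two embeddings, T embeds into W = range psi, so every subtree
   of T containing W is a twin of T. The bad component hangs from W by a single
   edge v r, and by Koenig's lemma it contains a ray v, r, ... infinitely many
   of whose vertices have a neighbour off the ray. For each set A of such
   vertices attach to W the ray with one pendant tooth at every vertex of A.
   Then A can be read off the non-backtracking walks starting with v r, so
   uncountably many sets arise from pairs of vertices of twins of T. Each twin
   is countable, hence yields only countably many, and finitely many
   isomorphism classes of twins cannot suffice. *)
From Stdlib Require Import Relation_Operators Operators_Properties.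
Require Import Defs.
From mathcomp Require Import all_boot all_classical zify.

Local Open Scope classical_set_scope.
Local Open Scope card_scope.

(** * Connectivity inside a vertex set of a fixed graph *)

Definition step_in {G : graph} (A : set G) (x y : G) : Prop :=
  [/\ A x, A y & adj x y].

(** A relation on [G] itself, so that [A] can be enlarged without changing the type of the
    vertices. *)
Definition joined_in {G : graph} (A : set G) : G -> G -> Prop :=
  clos_refl_trans G (step_in A).

Definition connected_set {G : graph} (A : set G) : Prop :=
  forall x y, A x -> A y -> joined_in A x y.

Section JoinedIn.
Context {G : graph}.
Implicit Types (A B : set G) (x y : G).

Lemma joined_in_sym A x y : joined_in A x y -> joined_in A y x.
Proof.
elim=> [a b [Aa Ab ab]|a|a b c _ ba _ cb].
- by apply: rt_step; split=> //; apply: adj_sym.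
- exact: rt_refl.
- exact: rt_trans cb ba.
Qed.

Lemma sub_joined_in A B x y : A `<=` B -> joined_in A x y -> joined_in B x y.
Proof.
move=> AB; elim=> [a b [Aa Ab ab]|a|a b c _ ab _ bc].
- by apply: rt_step; split=> //; apply: AB.
- exact: rt_refl.
- exact: rt_trans ab bc.
Qed.

Lemma star_connected_set A x :
  (forall y, A y -> joined_in A x y) -> connected_set A.
Proof.
by move=> h y z /h/joined_in_sym xy /h xz; apply: rt_trans xy xz.
Qed.

Lemma connected_setU A B x :
  connected_set A -> connected_set B -> A x -> B x -> connected_set (A `|` B).
Proof.
move=> cA cB Ax Bx; apply: (@star_connected_set _ x) => y [Ay|By].
- by apply: sub_joined_in (cA x y Ax Ay) => z; left.
- by apply: sub_joined_in (cB x y Bx By) => z; right.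
Qed.

Lemma connected_setU1 A x y :
  connected_set A -> A x -> adj x y -> connected_set (A `|` [set y]).
Proof.
move=> cA Ax xy; apply: (@star_connected_set _ x) => z [Az|->].
- by apply: sub_joined_in (cA x z Ax Az) => t; left.
- by apply: rt_step; split=> //; [left|right].
Qed.

Lemma joined_induced A (x y : induced A) :
  joined x y -> joined_in A (sval x) (sval y).
Proof.
elim=> [a b ab|a|a b c _ ab _ bc].
- by apply: rt_step; split=> //; apply: svalP.
- exact: rt_refl.
- exact: rt_trans ab bc.
Qed.

Lemma induced_joined A x y (Ax : A x) (Ay : A y) :
  joined_in A x y -> @joined (induced A) (exist _ x Ax) (exist _ y Ay).
Proof.
move=> /clos_rt_rt1n_iff xy; elim: xy Ax Ay => [a|a b c [_ Ab ab] _ IH] Aa Ac.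
  by rewrite (Prop_irrelevance Aa Ac); apply: rt_refl.
by apply: rt_trans (IH Ab Ac); apply: rt_step.
Qed.

Lemma connected_image {H : graph} (f : H -> G) :
  connected H -> (forall x y : H, adj x y -> adj (f x) (f y)) ->
  connected_set (range f).
Proof.
move=> [_ cH] fadj _ _ [x _ <-] [y _ <-].
elim: (cH x y) => [a b ab|a|a b c _ ab _ bc].
- by apply: rt_step; split; [exists a|exists b|apply: fadj].
- exact: rt_refl.
- exact: rt_trans ab bc.
Qed.

Lemma joined_in_uniq_path A x y : joined_in A x y -> A x ->
  exists s : seq {classic G},
    [/\ path (fun a b => `[< step_in A a b >]) x s, last (x : {classic G}) s = y
       & uniq ((x : {classic G}) :: s)].
Proof.
move=> /clos_rt_rt1n_iff xy Ax.
have [s [ps ls]] : exists s : seq {classic G},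
    path (fun a b => `[< step_in A a b >]) x s /\ last (x : {classic G}) s = y.
  elim: xy {Ax} => [a|a b c ab _ [s [ps ls]]]; first by exists [::].
  by exists (b :: s); split=> //=; rewrite ps andbT; apply/asboolP.
by case: (@shortenP {classic G} _ _ _ ps) ls => s' ps' us' _ ls; exists s'.
Qed.

(** A simple path in [A] from [x] to [y] with at least one edge would close up through [z] to a
    cycle. *)
Lemma unique_neighbour_in_connected_set A x y z : acyclic G ->
  connected_set A -> ~ A z -> A x -> A y -> adj z x -> adj z y -> x = y.
Proof.
move=> acG cA nAz Ax Ay zx zy.
have [s [ps ls us]] := joined_in_uniq_path _ _ _ (cA x y Ax Ay) Ax.
case: s ps ls us => [|a s] ps ls us; first by rewrite -ls.
have allA : forall b, b \in (x : {classic G}) :: a :: s -> A b.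
  move=> b; rewrite inE => /orP[/eqP ->//|bs].
  move: ps; elim: {ls us} (a :: s) (x : {classic G}) bs => // c t IH d.
  rewrite inE /= => bt /andP[/asboolP[_ Ac _] pt].
  by case/orP: bt => [/eqP->//|bt]; exact: IH bt pt.
pose c := (z : {classic G}) :: x :: a :: s.
have uc : uniq c.
  by rewrite /c cons_uniq us andbT; apply/negP => /allA.
have pc : path (fun u w => `[< adj (u : G) w >]) z (behead c).
  rewrite /= asboolT //=.
  by apply: sub_path ps => u w /asboolP[_ _ uw]; apply/asboolP.
case: (acG (size c) (fun i => nth (z : {classic G}) c i)); split=> //.
  move=> i j eq_ij; apply/val_inj/eqP.
  by rewrite -(nth_uniq (z : {classic G}) _ _ uc) ?ltn_ord//; apply/eqP.
move=> i; rewrite /ordS /=.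
have := ltn_ord i; rewrite [size c]/= => ilt.
(* Only the last index wraps around, and there the edge needed is the one from [y] back to [z]. *)
case: (ltnP i (size c).-1) => isz.
  rewrite modn_small; last by move: isz => /=; lia.
  exact/asboolP/(pathP _ pc).
have -> : nat_of_ord i = (size c).-1 by move: isz => /=; lia.
rewrite modnn nth_last /=; change (adj (last (x : {classic G}) (a :: s)) z).
by rewrite ls; apply: adj_sym.
Qed.

End JoinedIn.

(** * Non-backtracking walks and the levels at which they branch *)

(* Directed edges [(x, y)] at the end of a non-backtracking walk of length
   [n.+1] that starts with the edge [(a, b)]. *)
Inductive descent {G : graph} (a b : G) : nat -> G -> G -> Prop :=
| descent0 : descent a b 0 a b
| descentS n x y z :
    descent a b n x y -> adj y z -> z <> x -> descent a b n.+1 y z.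

(** The levels at which walks fork, an isomorphism invariant of [(a, b)]. Level 0 carries only the
    edge [(a, b)], hence the shift to [n.+1]. *)
Definition profile {G : graph} (a b : G) : set nat :=
  [set n | exists x y z,
     [/\ y <> z, descent a b n.+1 x y & descent a b n.+1 x z]].

Lemma embedding_descent {G H : graph} (f : G -> H) a b n x y :
  embedding f -> descent a b n x y -> descent (f a) (f b) n (f x) (f y).
Proof.
move=> [finj fadj]; elim=> [|{x y}{}n x y z _ IH yz zx]; first exact: descent0.
by apply: descentS IH _ _; [apply: fadj|move/finj].
Qed.

Lemma embedding_profile {G H : graph} (f : G -> H) a b :
  embedding f -> profile a b `<=` profile (f a) (f b).
Proof.
move=> ef n [x [y [z [yz xy xz]]]]; exists (f x), (f y), (f z).
split; [by move/(proj1 ef)|exact: embedding_descent..].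
Qed.

Definition profiles (G : graph) : set (set nat) :=
  [set P | exists a b : G, P = profile a b].

Lemma isomorphic_refl G : isomorphic G G.
Proof. by exists id; split=> //; exists id. Qed.

Lemma sub_isomorphic_profiles {G H : graph} :
  isomorphic G H -> profiles G `<=` profiles H.
Proof.
move=> [f [[g fK gK] fadj]] _ [a [b ->]]; exists (f a), (f b).
apply/seteqP; split.
  by apply: embedding_profile; split=> [|x y]; [exact: can_inj fK|rewrite fadj].
rewrite -[in X in _ `<=` X](fK a) -[in X in _ `<=` X](fK b).
apply: embedding_profile; split=> [|x y]; first exact: can_inj gK.
by rewrite -fadj !gK.
Qed.

(** * Countability and the counting of twins *)

Lemma countable_profiles {G : graph} :
  countable [set: G] -> countable (profiles G).
Proof.
move=> cG; have -> : profiles G =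
    \bigcup_(a in [set: G]) \bigcup_(b in [set: G]) [set profile a b].
  apply/seteqP; split=> [_ [a [b ->]]|_ [a _ [b _ ->]]]; last by exists a, b.
  by exists a => //; exists b.
by do 2 (apply: bigcup_countable => // ? _).
Qed.

Lemma locally_finite_countable {G : graph} :
  connected G -> locally_finite G -> countable [set: G].
Proof.
move=> [[o _] cG] lf.
(* [ball n] holds the ends of walks of length exactly [n] from [o]. *)
pose ball := fix ball n : set G :=
  if n is m.+1 then \bigcup_(x in ball m) neighbours x else [set o].
have fin n : finite_set (ball n).
  by elim: n => [|n IH] /=; [exact: finite_set1|exact: bigcup_finite].
apply: (@sub_countable _ _ _ (\bigcup_n ball n)); last first.
  by apply: bigcup_countable => // n _; apply: finite_set_countable.
apply: subset_card_le => x _; have /clos_rt_rtn1_iff := cG o x.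
elim=> [|y z yz _ [n _ by_]]; first by exists 0.
by exists n.+1 => //; exists y.
Qed.

Lemma induced_is_tree {G : graph} (A : set G) :
  acyclic G -> connected_set A -> A !=set0 -> is_tree (induced A).
Proof.
move=> acG cA [x Ax]; split; [split|].
- by exists (exist _ x Ax).
- by move=> [y Ay] [z Az]; apply: induced_joined; apply: cA.
- move=> n c [n2 cinj cadj]; apply: (acG n (fun i => sval (c i))); split=> //.
  move=> i j eq_ij; apply: cinj.
  by case: (c i) (c j) eq_ij => [u Au] [w Aw] /= uw; apply: eq_exist.
Qed.

Lemma embedding_sval {G : graph} (A : set G) :
  embedding (fun x : induced A => sval x).
Proof. by split=> // -[x Ax] [y Ay] /= xy; apply: eq_exist. Qed.

(** Cantor's diagonal argument, carried into [I] by an injection [e] of the naturals: [A] contains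
    [e n] when [n] codes a member of [F] that omits [e n]. *)
Lemma uncountable_subsets {I : set nat} (F : set (set nat)) :
  infinite_set I -> (forall A, A `<=` I -> F A) -> ~ countable F.
Proof.
move=> /infiniteP/pcard_leP[e] FI /countable_injP[g ginj].
pose A := [set e n | n in [set n | exists P, [/\ F P, g P = n & ~ P (e n)]]].
have FA : F A by apply: FI => _ [n _ <-]; apply: funS.
have einj m n : e m = e n -> m = n by apply: (@inj _ _ _ e); rewrite inE.
have nA : ~ A (e (g A)).
  move=> /[dup] Ag [n [P [FP gP nP]] /einj en].
  have PA : P = A by apply: ginj; rewrite ?inE ?gP.
  by apply: nP; rewrite PA en.
by apply: (nA); exists (g A) => //; exists A.
Qed.

(* Finitely many countable twins have countably many profiles in total. *)
Lemma infinite_twin_classes {T : graph} {I : set nat} :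
  countable [set: T] -> infinite_set I ->
  (forall A, A `<=` I -> exists H : graph,
     [/\ is_tree H, twin H T & profiles H A]) ->
  infinite_set (twin_classes T).
Proof.
move=> cT infI TA fin.
pose F := \bigcup_(c in twin_classes T) \bigcup_(H in c) profiles H.
apply: (@uncountable_subsets I F infI) => [A /TA[H [tH HT HA]]|].
  exists (iso_class H); first by exists H.
  by exists H => //; apply: isomorphic_refl.
apply: bigcup_countable => [|_ [H [_ [[f [finj _]] _]] <-]].
  exact: finite_set_countable.
have cH : countable [set: H].
  have /countable_injP[g ginj] := cT.
  apply/countable_injP; exists (g \o f) => x y _ _ /= /ginj.
  by rewrite !inE => h; apply/finj/h.
have sub : \bigcup_(K in iso_class H) profiles K `<=` profiles H.
  move=> P [K [f' [[g fK gK] fadj]]]; apply: sub_isomorphic_profiles.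
  by exists g; split; [exists f'|move=> x y; rewrite -fadj !gK].
exact: sub_countable (subset_card_le sub) (countable_profiles cH).
Qed.

(** * A ray with infinitely many teeth *)

Lemma embedding_comp {G H K : graph} (f : G -> H) (g : H -> K) :
  embedding f -> embedding g -> embedding (g \o f).
Proof.
move=> [finj fadj] [ginj gadj]; split=> [x y /ginj/finj//|x y /fadj/gadj//].
Qed.

Lemma embedding_neighbours {G H : graph} (f : G -> H) x :
  embedding f -> neighbours x #<= neighbours (f x).
Proof.
move=> [finj fadj]; have fK : {in neighbours x &, injective f}.
  by move=> ? ? _ _; apply: finj.
apply: (@card_le_trans _ _ _ (f @` neighbours x)).
  by have := inj_card_eq fK; rewrite card_eq_le => /andP[].
by apply: subset_card_le => _ [y xy <-]; apply: fadj.
Qed.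

Lemma branch_vertex_third_neighbour {G : graph} {x : G} a b :
  branch_vertices G x -> exists c, [/\ adj x c, c <> a & c <> b].
Proof.
move=> bx; apply: contrapT => nc.
have sub : neighbours x `<=` (fun n => if n is 0 then a else b) @` `I_2.
  move=> c xc; case: (pselect (c = a)) => [->|ca]; first by exists 0.
  case: (pselect (c = b)) => [->|cb]; first by exists 1.
  by case: nc; exists c.
have := card_le_trans (subset_card_le sub) (card_image_le _ _).
by move=> /(card_le_trans bx); rewrite card_le_II.
Qed.

(* The component of [y] in [G - x]. *)
Definition side {G : graph} (x y : G) : set G := joined_in (~` [set x]) y.

(** Cut the walk at its last visit to [y]; [t] is the vertex that follows. This splits a side into
    [y] and smaller sides, one for each further neighbour. *)
Lemma side_cases {G : graph} (x y z : G) : side x y z ->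
  z = y \/ exists2 t, adj y t /\ t <> x & side y t z.
Proof.
move=> /clos_rt_rtn1_iff; elim=> [|u w [_ wx uw] _ IH]; first by left.
case: (pselect (w = y)) => [|wy]; [by left|right].
case: (pselect (u = y)) => [uy|uy].
  by rewrite uy in uw; exists w => //; apply: rt_refl.
case: IH => // -[t ytx tu]; exists t => //.
by apply: rt_trans tu _; apply: rt_step.
Qed.

(** The edge [v r] is the last one by which the walk leaves [W]. *)
Lemma joined_boundary {G : graph} (W : set G) x z :
  joined x z -> W x -> ~ W z ->
  exists v r, [/\ W v, ~ W r, adj v r & joined_in (~` W) r z].
Proof.
move=> /clos_rt_rt1n_iff xz Wx nWz.
suff : (~ W x /\ joined_in (~` W) x z) \/
    exists v r, [/\ W v, ~ W r, adj v r & joined_in (~` W) r z].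
  by case=> // -[].
elim: xz nWz {Wx} => [a|a b c ab _ IH] nWc.
  by left; split=> //; apply: rt_refl.
case: (IH nWc) => [[nWb bc]|]; last by right.
case: (pselect (W a)) => Wa; first by right; exists a, b.
by left; split=> //; apply: rt_trans bc; apply: rt_step.
Qed.

(** A side meeting [B] infinitely often is, up to one vertex, a union of finitely many smaller
    sides, so one of these meets [B] infinitely often too; iterate. *)
Lemma konig_ray {G : graph} (B : set G) v r :
  locally_finite G -> adj v r -> infinite_set (side v r `&` B) ->
  exists X : nat -> G,
    [/\ X 0 = v, X 1 = r, forall n, adj (X n) (X n.+1),
        forall n, X n.+2 <> X n
      & forall n, infinite_set (side (X n) (X n.+1) `&` B)].
Proof.
move=> lf vr infB.
pose good (p : G * G) := adj p.1 p.2 /\ infinite_set (side p.1 p.2 `&` B).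
have next (p : G * G) : exists q : G * G,
    good p -> [/\ good q, q.1 = p.2 & q.2 <> p.1].
  (* A pair that is not good gets itself as a dummy successor, which makes the choice function
     total. *)
  case: p => x y; case: (pselect (good (x, y))); last by exists (x, y).
  move=> [/= xy inf].
  apply: contrapT => nq; apply: inf.
  (* Placing [t <> x] inside the sets lets the union run over all neighbours of [y]; the term for
     [t = x] is empty. *)
  apply: (@sub_finite_set _ _ ([set y] `|` \bigcup_(t in neighbours y)
      [set z | t <> x /\ (side y t `&` B) z])).
    move=> z [/side_cases[->|[t [yt tx] tz]] Bz]; first by left.
    by right; exists t.
  rewrite finite_setU; split; first exact: finite_set1.
  apply: bigcup_finite => [|t yt]; first exact: lf.
  case: (pselect (t = x)) => [->|tx].
    by apply: sub_finite_set (finite_set0 _) => ? [].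
  apply: (@sub_finite_set _ _ (side y t `&` B)) => [z []//|].
  by apply: contrapT => inft; apply: nq; exists (y, t).
have [f fP] := choice next.
pose p n := iter n f (v, r).
have gp n : good (p n) by elim: n => [//|n /fP[]].
have p1 n : (p n.+1).1 = (p n).2 by have [] := fP _ (gp n).
exists (fun n => (p n).1); split=> // n; rewrite ?p1.
- exact: (proj1 (gp n)).
- by have [] := fP _ (gp n).
- exact: (proj2 (gp n)).
Qed.

(** If no tooth came after [N], the side beyond [X N.+1] would consist of ray vertices only. It
    contains a branch vertex, whose third neighbour is a later tooth. *)
Lemma infinite_ray_teeth {G : graph} (X : nat -> G) :
  (forall n, infinite_set (side (X n) (X n.+1) `&` branch_vertices G)) ->
  infinite_set [set n | exists y, [/\ adj (X n.+1) y, y <> X n & y <> X n.+2]].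
Proof.
set I := [set n | _] => inf /finite_seqP[s Is].
pose N := \max_(i <- s) i.
have nI n : N < n -> ~ I n.
  move=> + In; rewrite Is in In.
  by rewrite ltnNge (leq_bigmax_seq n).
have [z [zX bz]] := infinite_setN0 (inf N.+1).
(* Without teeth the walk can only move along the ray, and it cannot pass back through [X N.+1]. *)
have [n Nn zn] : exists2 n, N.+1 < n & z = X n.
  move: zX => /clos_rt_rtn1_iff; elim=> [|u w [_ wX uw] _ [[//|n] Nn un]].
    by exists N.+2.
  case: (pselect (w = X n.+2)) => [->|w2]; first by exists n.+2 => //; lia.
  case: (pselect (w = X n)) => [wn|w0]; last first.
    by case: (nI n) => //; exists w; rewrite -un.
  exists n => //; case: (ltngtP n N.+1) Nn => // [|nN]; first by lia.
  by case: wX; rewrite wn nN.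
case: n Nn zn => // n Nn zn.
have [y [zy yX yX']] := branch_vertex_third_neighbour (X n) (X n.+2) bz.
by case: (nI n) => //; exists y; rewrite -zn.
Qed.

(** * Walks leaving [W] in a tree, and combs *)

Section Descent.
Context {T : graph} (W : set T) (v r : T).
Hypotheses (acT : acyclic T) (cW : connected_set W).
Hypotheses (Wv : W v) (nWr : ~ W r) (vr : adj v r).

Lemma descent_adj {n x y} : descent v r n x y -> adj x y.
Proof. by case. Qed.

(** [K] is [W] together with the vertices of the walk before [y]. If the next vertex lay in [K],
    then [y] would have two neighbours in a connected set that misses it. *)
Lemma descent_separated {n x y} : descent v r n x y ->
  exists K : set T, [/\ connected_set K, W `<=` K, K x & ~ K y].
Proof.
elim=> [|{x y}{}n x y z xy [K [cK WK Kx nKy]] yz zx]; first by exists W; split.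
have /adj_sym yx := descent_adj xy.
exists (K `|` [set y]); split.
- by apply: connected_setU1 Kx _ => //; apply: adj_sym.
- by move=> w /WK; left.
- by right.
- case=> [Kz|zy]; last by apply: (@adj_irr _ y); rewrite -{2}zy.
  by apply: zx; apply: unique_neighbour_in_connected_set nKy Kz Kx yz yx.
Qed.

Lemma descent_notin {n x y} : descent v r n x y -> ~ W y.
Proof. by case/descent_separated=> K [_ WK _ nKy] /WK. Qed.

Lemma descent_pred {n x y} : descent v r n x y ->
  (n = 0 /\ x = v) \/ exists m w, n = m.+1 /\ descent v r m w x.
Proof. by case=> [|m w z t wz _ _]; [left|right; exists m, w]. Qed.

(** The separating sets of both walks contain [v], so their union is connected and misses [y]; hence
    the predecessors agree. Induction then matches the lengths, a walk of length one being
    recognised by its start [v] in [W]. *)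
Lemma descent_unique {n m x x' y} :
  descent v r n x y -> descent v r m x' y -> n = m /\ x = x'.
Proof.
elim: n m x x' y => [|n IH] m x x' y xy x'y.
all: have [K [cK WK Kx nKy]] := descent_separated xy.
all: have [K' [cK' WK' Kx' nKy']] := descent_separated x'y.
all: have xx' : x = x' by
  apply: (unique_neighbour_in_connected_set (K `|` K') _ _ y acT);
  [apply: connected_setU cK cK' (WK v Wv) (WK' v Wv)|case|left|right|
   exact/adj_sym/(descent_adj xy)|exact/adj_sym/(descent_adj x'y)].
all: split=> //; rewrite -{}xx' in x'y *.
all: case: (descent_pred xy) => [[// _ xv]|[n1 [w [// [<-] wx]]]].
all: case: (descent_pred x'y) => [[-> // x'v]|[m' [w' [-> w'x]]]].
- by case: (descent_notin w'x); rewrite xv.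
- by case: (descent_notin wx); rewrite x'v.
- by have [->] := IH _ _ _ _ wx w'x.
Qed.

Section Comb.
Context (X y : nat -> T) (A : set nat).
Hypotheses (X0 : X 0 = v) (X1 : X 1 = r).
Hypotheses (Xadj : forall n, adj (X n) (X n.+1)) (XX : forall n, X n.+2 <> X n).
Hypothesis yP : forall n, A n ->
  [/\ adj (X n.+1) (y n), y n <> X n & y n <> X n.+2].

(** The tooth [y n] hangs from [X n.+1], so it creates a fork at level [n.+1], in line with the
    shift in [profile]. *)
Definition comb : set T := W `|` (range X `|` y @` A).

Lemma descent_ray n : descent v r n (X n) (X n.+1).
Proof.
elim: n => [|n IH]; first by rewrite X0 X1; apply: descent0.
by apply: descentS IH _ _.
Qed.

Lemma descent_tooth {n} : A n -> descent v r n.+1 (X n.+1) (y n).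
Proof. by move=> /yP[? ? ?]; apply: descentS (descent_ray n) _ _. Qed.

Lemma comb_ray n : comb (X n).
Proof. by right; left; exists n. Qed.

Lemma connected_comb : connected_set comb.
Proof.
have cX : connected_set (range X).
  apply: (@star_connected_set _ _ (X 0)) => _ [n _ <-].
  elim: n => [|n IH]; first exact: rt_refl.
  by apply: rt_trans IH _; apply: rt_step; split=> //; eexists.
have cWX : connected_set (W `|` range X).
  by apply: (@connected_setU _ _ _ v) => //; exists 0.
apply: (@star_connected_set _ _ v) => z.
have sub : W `|` range X `<=` comb by move=> ? [?|?]; [left|right; left].
have vX z' : (W `|` range X) z' -> joined_in comb v z'.
  by move=> z'X; apply: sub_joined_in sub _; apply: cWX => //; left.
case=> [Wz|[zX|[n An <-]]]; [by apply: vX; left|by apply: vX; right|].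
apply: (@rt_trans _ _ _ (X n.+1)); first by apply: vX; right; exists n.+1.
have [Xy _ _] := yP n An; apply: rt_step; split=> //; first exact: comb_ray.
by right; right; exists n.
Qed.

(** Ray edges and teeth are themselves ends of walks in [T], so uniqueness there fixes the level and
    predecessor of each comb vertex reached. *)
Lemma descent_comb {n} {a b p q : induced comb} :
  sval a = v -> sval b = r -> descent a b n p q ->
  sval p = X n /\
  (sval q = X n.+1 \/ exists m, [/\ n = m.+1, A m & sval q = y m]).
Proof.
move=> av br d.
have : forall m p q, descent a b m p q -> descent v r m (sval p) (sval q).
  move=> m p' q' /(embedding_descent _ _ _ _ _ _ (embedding_sval comb)).
  by rewrite av br.
move=> dT; elim: d => [|{p q}{}n p q s pq [pX qX] qs sp].
  by rewrite av br; auto.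
have ds := dT _ _ _ (descentS _ _ _ _ _ _ pq qs sp).
have scomb := svalP s.
case: qX => [qX|[m [nm Am qy]]].
  split=> //; case: scomb => [/(descent_notin ds)//|[[j _ js]|[j Aj js]]].
    (* For [j = 0] the vertex is [v], which no walk reaches since [v] lies in [W]. *)
    left; have := descent_ray j.-1; case: j js => [|j] js.
      by have := descent_notin ds; rewrite -js X0.
    by rewrite js => /= dj; have [<- _] := descent_unique dj ds.
  right; exists j; split=> //; have := descent_tooth Aj; rewrite js => dj.
  by have [[->]] := descent_unique dj ds.
(* No walk continues past a tooth: the predecessor of the next vertex would be a ray vertex, which
   forces [y m = X m.+2]. *)
exfalso; have [_ _ yX] := yP _ Am.
case: scomb => [/(descent_notin ds)//|[[[|j] _ js]|[j Aj js]]].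
- by have := descent_notin ds; rewrite -js X0.
- have := descent_ray j; rewrite js => dj.
  have [jn Xq] := descent_unique dj ds.
  by apply: yX; rewrite -qy -Xq jn nm.
- have := descent_tooth Aj; rewrite js => dj.
  have [[jn] Xq] := descent_unique dj ds.
  by apply: yX; rewrite -qy -Xq jn nm.
Qed.

Lemma profile_comb : profiles (induced comb) A.
Proof.
have Cv : comb v by left.
have Cr : comb r by rewrite -X1; apply: comb_ray.
pose a : induced comb := exist _ v Cv; pose b : induced comb := exist _ r Cr.
pose x n : induced comb := exist _ (X n) (comb_ray n).
have dx n : descent a b n (x n) (x n.+1).
  elim: n => [|n IH].
    have -> : x 0 = a by apply: eq_exist.
    have -> : x 1 = b by apply: eq_exist.
    exact: descent0.
  by apply: (descentS _ _ _ _ _ (x n.+2) IH (Xadj n.+1)) => -[] /XX.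
exists a, b; apply/seteqP; split=> [n An|n [p [q [s [qs pq ps]]]]].
  have Cy : comb (y n) by right; right; exists n.
  have [Xy yX yX'] := yP _ An.
  pose t : induced comb := exist _ (y n) Cy.
  exists (x n.+1), (x n.+2), t; split.
  - by case=> /esym.
  - exact: dx.
  - by apply: (descentS _ _ _ _ _ t (dx n) Xy) => -[].
(* An end that is a tooth at level [n.+1] puts [n] in [A]. Otherwise both ends are [X n.+2],
   although they are distinct. *)
have [_ [qX|[m [[<-] //]]]] := @descent_comb _ a b _ _ (erefl v) (erefl r) pq.
have [_ [sX|[m [[<-] //]]]] := @descent_comb _ a b _ _ (erefl v) (erefl r) ps.
by case: qs; apply: (proj1 (embedding_sval comb)); rewrite qX sX.
Qed.

End Comb.
End Descent.

(** * Assembling the twins *)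

Theorem theorem3 (T S : graph)
    (treeT : is_tree T) (lfT : locally_finite T)
    (treeS : is_tree S) (twinST : twin S T) :
  (exists psi : S -> T, embedding psi /\
     exists C : set (delete (range psi)),
       components (delete (range psi)) C /\ ~ nearly_finite (induced C)) ->
  infinite_set (twin_classes T).
Proof.
move=> [psi [epsi [_ [[d _ <-] nfC]]]].
have [cT acT] := treeT; have [cS _] := treeS; have [_ [phi ephi]] := twinST.
have [s0 _] := proj1 cS; pose W := range psi.
have cW : connected_set W := connected_image psi cS (proj2 epsi).
have Ws0 : W (psi s0) by exists s0.
have [v [r [Wv nWr vr rd]]] :=
  joined_boundary _ _ _ (proj2 cT (psi s0) (sval d)) Ws0 (svalP d).
have eC :=
  embedding_comp _ _ (embedding_sval (joined d)) (embedding_sval (~` W)).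
set iota := _ \o _ in eC.
(* Degrees do not drop along [iota], so branch vertices of the component are branch vertices of [T],
   and paths avoiding [W] avoid [v]. A finite intersection would thus make the component nearly
   finite. *)
have infB : infinite_set (side v r `&` branch_vertices T).
  move=> finB; apply: nfC; split=> [x|].
    exact: card_le_finite (embedding_neighbours _ x eC) (lfT _).
  have sub : branch_vertices (induced (joined d)) `<=`
      iota @^-1` (side v r `&` branch_vertices T).
    move=> x bx; split; last first.
      exact: card_le_trans bx (embedding_neighbours _ x eC).
    have := rt_trans _ _ _ _ _ rd (joined_induced _ _ _ (svalP x)).
    by apply: sub_joined_in => z nWz zv; apply: nWz; rewrite zv.
  apply: sub_finite_set sub (finite_preimage _ finB) => x y _ _.
  exact: (proj1 eC).
have [X [X0 X1 Xadj XX Xinf]] := konig_ray _ _ _ lfT vr infB.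
have infI := infinite_ray_teeth _ Xinf; set I := [set n | _] in infI.
have [y yP] : exists y : nat -> T, forall n, I n ->
    [/\ adj (X n.+1) (y n), y n <> X n & y n <> X n.+2].
  have /choice[y yP] : forall n, exists z, I n ->
      [/\ adj (X n.+1) z, z <> X n & z <> X n.+2].
    (* Outside [I] the value [v] is a dummy. *)
    by move=> n; case: (pselect (I n)) => [[z]|]; [exists z|exists v].
  by exists y.
apply: (infinite_twin_classes (locally_finite_countable cT lfT) infI) => A AI.
have yA n : A n -> _ := fun An => yP n (AI n An).
exists (induced (comb W X y A)); split.
- apply: induced_is_tree => //; last by exists v; left.
  exact: (connected_comb W v cW).
- split; first by eexists; exact: embedding_sval.
  (* The self-embedding of [T] through [S] has its image in [W], hence in every comb. *)
  have [inj hadj] := embedding_comp _ _ ephi epsi.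
  have Cf x : comb W X y A (psi (phi x)) by left; eexists.
  exists (fun x => exist _ _ (Cf x)); split=> [a b [] /inj//|a b /hadj//].
- exact: (profile_comb W v r acT cW).
Qed.
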